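(* Let $C\subseteq S^q$ be a convolutional code (an $S$-submodule of $S^q$). Any two minimal reduced polynomial resolutions of $C$ are equivalent (in particular, they have the same length).
   Context: Setting. $\mathbb F$ is an arbitrary field, $n\ge 1$ an integer, $D=(D_1,\ldots,D_n)$ indeterminates, $S=\mathbb F[D]$. $S_{\le d}$ is the space of polynomials of (total) degree $\le d$ ($d\in\mathbb Z$). A convolutional code of length $q$ is a submodule of $S^q$. All polynomial matrices considered are assumed to have no zero column. Degrees. A twisting (degree) function of length $p$ is a function $a:[1,p]=\{1,\ldots,p\}\to\mathbb Z_+=\{0,1,2,\ldots\}$. For $f\in S^p$, $\deg_a(f)=\max_i\{a(i)+\deg(f_i)\}$ (and $-\infty$ if $f=0$). For $G\in S^{p\times q}$ with no zero column, $\deg_a(G):[1,q]\to\mathbb Z_+$ sends $j$ to the $a$-degree of the $j$-th column of $G$. Polynomial complexes. A polynomial complex of length $l\ge 1$ and size $q\times(p_l,\ldots,p_1)$ ($p_i\geq 1$) is a sequence $(G_l,\ldots,G_1)$ of matrices over $S$, where $G_1$ is $q\times p_1$ and $G_i$ is $p_{i-1}\times p_i$ for $i\ge2$, such that $G_1G_2=0,\ldots,G_{l-1}G_l=0$. It is a polynomial resolution if $0\to S^{p_l}\xrightarrow{G_l}\cdots\to S^{p_1}\xrightarrow{G_1}S^q$ is exact (at every term except $S^q$); it is a polynomial resolution of $C$ if moreover $\mathrm{Im}(G_1)=C$. Its column degree table $(a_l,\ldots,a_1)$ is defined recursively by $a_0=0$ (the zero function on $[1,q]$; put $p_0=q$)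 and $a_{i+1}=\deg_{a_i}(G_{i+1})$. Reducedness. For a polynomial complex $G$, let $G_k^L$ be the matrix over $S$ of the same size as $G_k$ whose $(i,j)$ entry is the homogeneous part of degree $a_k(j)-a_{k-1}(i)$ of the $(i,j)$ entry of $G_k$ (zero if this number is negative). $G$ is (column) reduced if the sequence $0\to S^{p_l}\xrightarrow{G_l^L}\cdots\xrightarrow{G_2^L}S^{p_1}\xrightarrow{G_1^L}S^q$ is exact (at every term except $S^q$). Filtered modules. A filtration on an $S$-module $M$ is an ascending chain $M_{\le0}\subseteq M_{\le1}\subseteq\cdots$ of $\mathbb F$-subspaces with $M=\bigcup_d M_{\le d}$ and $D_kM_{\le d}\subseteq M_{\le d+1}$ for all $k,d$; put $M_{\le -1}=0$. A homomorphism of filtered modules is an $S$-homomorphism $u:M\to N$ with $u(M_{\le d})\subseteq N_{\le d}$ for all $d\geq 0$; an isomorphism is a homomorphism with a two-sided inverse that is a homomorphism of filtered modules. $S^p[-a]$ denotes $S^p$ with the filtration $S^p[-a]_{\le d}=\{f\in S^p:\deg_a(f)\le d\}$; submodules carry the induced filtration (intersection), and $C[0]$ denotes $C\subseteq S^q$ with $C_{\le d}=C\cap(S_{\le d})^q$. For a filtered module $M$ and $d\ge0$, $\Gamma_d(M)=M_{\le d}/(M_{\le d-1}+D_1M_{\le d-1}+\cdots+D_nM_{\le d-1})$. A homomorphism $u:M\to N$ of filtered modules is minimal if for every $d\ge0$ the map $u:M_{\le d}\to N_{\le d}$ is surjective and the induced map $\Gamma_d(u):\Gamma_d(M)\to\Gamma_d(N)$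 is bijective. Minimal resolutions. A reduced polynomial resolution $G=(G_l,\ldots,G_1)$ with $C=\mathrm{Im}(G_1)$ is minimal if, in the sequence of filtered modules $0\to S^{p_l}[-a_l]\xrightarrow{G_l}\cdots\xrightarrow{G_2}S^{p_1}[-a_1]\xrightarrow{G_1}C[0]\to0$, the homomorphism $G_1:S^{p_1}[-a_1]\to C[0]$ is minimal and, for each $2\le i\le l$, the homomorphism $G_i:S^{p_i}[-a_i]\to\ker(G_{i-1})$ is minimal, where $\ker(G_{i-1})\subseteq S^{p_{i-1}}$ has the filtration induced from $S^{p_{i-1}}[-a_{i-1}]$. Equivalence. Two reduced polynomial resolutions $G=(G_l,\ldots,G_1)$ and $G'=(G'_l,\ldots,G'_1)$ of the same length $l$, of sizes $q\times(p_l,\ldots,p_1)$ and $q\times(p'_l,\ldots,p'_1)$ and with column degree tables $(a_l,\ldots,a_1)$ and $(a'_l,\ldots,a'_1)$, are equivalent if there exist isomorphisms of filtered modules $U_i:S^{p_i}[-a_i]\to S^{p'_i}[-a'_i]$, $i=1,\ldots,l$, such that $G'_1U_1=G_1$ and $G'_iU_i=U_{i-1}G_i$ for $2\le i\le l$. *)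

(* Defs.v *)
From HB Require Import structures.
From mathcomp Require Import all_boot all_order all_algebra.
From mathcomp Require Import boolp classical_sets functions.
From mathcomp Require Import mpoly.

Set Implicit Arguments.
Unset Strict Implicit.
Unset Printing Implicit Defensive.

Import GRing.Theory.
Local Open Scope ring_scope.
Local Open Scope classical_set_scope.

Section Submodules.
Variables (R : comNzRingType).

(* Prop-valued, so that arbitrary (not only decidable) submodules are
   covered. *)
Record submodule (V : lmodType R) := Submodule {
  submod_set :> set V;
  submod0 : submod_set 0;
  submodD : forall x y, submod_set x -> submod_set y -> submod_set (x + y);
  submodZ : forall c x, submod_set x -> submod_set (c *: x)
}.

Variables (p r : nat) (A : 'M[R]_(p, r)).

Fact mxker0 : [set x : 'cV[R]_r | A *m x = 0] 0.
Proof. exact: mulmx0. Qed.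

Fact mxkerD x y : [set x : 'cV[R]_r | A *m x = 0] x ->
  [set x : 'cV[R]_r | A *m x = 0] y ->
  [set x : 'cV[R]_r | A *m x = 0] (x + y).
Proof. by move=> /= Ax Ay; rewrite mulmxDr Ax Ay addr0. Qed.

Fact mxkerZ c x : [set x : 'cV[R]_r | A *m x = 0] x ->
  [set x : 'cV[R]_r | A *m x = 0] (c *: x).
Proof. by move=> /= Ax; rewrite -scalemxAr Ax scaler0. Qed.

Definition mxker : submodule 'cV[R]_r := Submodule mxker0 mxkerD mxkerZ.

Fact mxim0 : range (fun x : 'cV[R]_r => A *m x) 0.
Proof. by exists 0; rewrite ?mulmx0. Qed.

Fact mximD x y : range (fun x : 'cV[R]_r => A *m x) x ->
  range (fun x : 'cV[R]_r => A *m x) y ->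
  range (fun x : 'cV[R]_r => A *m x) (x + y).
Proof. by move=> [u _ <-] [v _ <-]; exists (u + v); rewrite ?mulmxDr. Qed.

Fact mximZ c x : range (fun x : 'cV[R]_r => A *m x) x ->
  range (fun x : 'cV[R]_r => A *m x) (c *: x).
Proof. by move=> [u _ <-]; exists (c *: u); rewrite ?scalemxAr. Qed.

Definition mxim : submodule 'cV[R]_p := Submodule mxim0 mximD mximZ.

End Submodules.

Section FilteredModules.
Variables (F : fieldType) (n : nat).
Local Notation S := {mpoly F[n]}.

(* A filtered module lives inside an ambient S-module: fil d is M_{<=d}, and
   the module M itself is their union [carrier M]. *)
Record filteredModule := FilteredModule {
  ambient :> lmodType S;
  fil : nat -> set ambient;
  fil0 : forall d, fil d 0;
  filD : forall d x y, fil d x -> fil d y -> fil d (x + y);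
  filZ : forall d (c : F) x, fil d x -> fil d (c%:MP *: x);
  fil_mono : forall d, fil d `<=` fil d.+1;
  filX : forall d (k : 'I_n) x, fil d x -> fil d.+1 ('X_k *: x)
}.

Definition carrier (M : filteredModule) : set M := \bigcup_d fil d.

Definition filtered_hom (M N : filteredModule) (u : M -> N) : Prop :=
  [/\ forall x y, carrier x -> carrier y -> u (x + y) = u x + u y,
      forall (s : S) x, carrier x -> u (s *: x) = s *: u x
    & forall d x, fil d x -> fil d (u x)].

Definition filtered_iso (M N : filteredModule) (u : M -> N) : Prop :=
  filtered_hom u /\
  exists v : N -> M,
    [/\ filtered_hom v, forall x, carrier x -> v (u x) = x
      & forall y, carrier y -> u (v y) = y].

Section Gamma.
Variables (M : filteredModule) (d : nat).

(* M_{<=d-1}, with M_{<=-1} = 0 *)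
Definition fil_pred : set M := if d is e.+1 then fil e else [set 0].

(* M_{<=d-1} + D_1 M_{<=d-1} + ... + D_n M_{<=d-1} *)
Definition Gamma_den : set M :=
  [set z | exists (x : M) (y : 'I_n -> M),
     [/\ fil_pred x, forall k, fil_pred (y k) & z = x + \sum_k 'X_k *: y k]].

Definition Gamma_coset (x : M) : set M := [set x + b | b in Gamma_den].

(* The quotient M_{<=d} / Gamma_den, as the set of its cosets. *)
Definition Gamma : set (set M) := Gamma_coset @` fil d.

End Gamma.

Arguments Gamma : clear implicits.

(* The induced map on cosets, A |-> u(A) + Gamma_den N d;
   see Gamma_map_coset. *)
Definition Gamma_map (M N : filteredModule) (u : M -> N) (d : nat)
    (A : set M) : set N :=
  [set u a + b | a in A & b in @Gamma_den N d].

Lemma fil_le (M : filteredModule) d e (x : M) :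
  (d <= e)%N -> fil d x -> fil e x.
Proof.
move=> /subnKC <-; elim: (e - d)%N => [|k IHk]; first by rewrite addn0.
by move=> dx; rewrite addnS; apply/fil_mono/IHk.
Qed.

Lemma fil_pred_fil (M : filteredModule) d (x : M) : fil_pred d x -> fil d x.
Proof. by case: d => [->|d]; [exact: fil0|exact: fil_mono]. Qed.

Lemma fil_predX (M : filteredModule) d k (x : M) :
  fil_pred d x -> fil d ('X_k *: x).
Proof. by case: d => [->|d]; [rewrite scaler0; exact: fil0|exact: filX]. Qed.

Lemma fil_predD (M : filteredModule) d (x y : M) :
  fil_pred d x -> fil_pred d y -> fil_pred d (x + y).
Proof. by case: d => [->->|d]; [rewrite addr0|exact: filD]. Qed.

Lemma fil_sum (M : filteredModule) d (y : 'I_n -> M) :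
  (forall k, fil d (y k)) -> fil d (\sum_k y k).
Proof. by move=> dy; elim/big_ind: _ => //; [exact: fil0|exact: filD]. Qed.

Lemma Gamma_den0 (M : filteredModule) d : @Gamma_den M d 0.
Proof.
exists 0, (fun=> 0); split; last by rewrite big1 ?addr0// => k _; rewrite scaler0.
  by case: d => [|d] //; exact: fil0.
by move=> k; case: d => [|d] //; exact: fil0.
Qed.

Lemma Gamma_denD (M : filteredModule) d (x y : M) :
  Gamma_den d x -> Gamma_den d y -> Gamma_den d (x + y).
Proof.
move=> [x0 [x1 [hx0 hx1 ->]]] [y0 [y1 [hy0 hy1 ->]]].
exists (x0 + y0), (fun k => x1 k + y1 k); split.
- exact: fil_predD.
- by move=> k; exact: fil_predD.
- rewrite addrACA -big_split; congr (_ + _).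
  by apply: eq_bigr => k _; rewrite scalerDr.
Qed.

Lemma Gamma_den_fil (M : filteredModule) d (x : M) : Gamma_den d x -> fil d x.
Proof.
move=> [x0 [x1 [hx0 hx1 ->]]]; apply: filD; first exact: fil_pred_fil.
by apply: fil_sum => k; exact: fil_predX.
Qed.

Lemma Gamma_den_hom (M N : filteredModule) (u : M -> N) d (x : M) :
  filtered_hom u -> Gamma_den d x -> Gamma_den d (u x).
Proof.
move=> [uD uZ uf] [x0 [x1 [hx0 hx1 ->]]].
have u0 : u 0 = 0.
  have c0 : carrier (0 : M) by exists 0%N => //; exact: fil0.
  by have := uZ 0 0 c0; rewrite !scale0r.
have up y : fil_pred d y -> fil_pred d (u y).
  by case: d {hx0 hx1} => [->|d] //=; exact: uf.
exists (u x0), (fun k => u (x1 k)); split; [exact: up|by move=> k; exact: up|].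
have cX k : fil d ('X_k *: x1 k) by exact: fil_predX.
have cs : u (\sum_k 'X_k *: x1 k) = \sum_k 'X_k *: u (x1 k).
  suff [] : fil d (\sum_k 'X_k *: x1 k) /\
            u (\sum_k 'X_k *: x1 k) = \sum_k 'X_k *: u (x1 k) by [].
  elim/big_rec2: _ => [|k z1 z2 _ [fz uz]]; first by split=> //; exact: fil0.
  split; first exact: filD.
  rewrite uD ?uz ?uZ //; exists d => //; exact: fil_pred_fil.
rewrite uD ?cs//; exists d => //; first exact: fil_pred_fil.
by apply: fil_sum.
Qed.

Lemma Gamma_map_coset (M N : filteredModule) (u : M -> N) d (x : M) :
  filtered_hom u -> fil d x ->
  Gamma_map u d (Gamma_coset d x) = Gamma_coset d (u x).
Proof.
move=> hu dx; apply/seteqP; split => y.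
- move=> [_ [a da <-] [b db <-]].
  exists (u a + b); first by apply: Gamma_denD => //; exact: Gamma_den_hom.
  have [uD _ _] := hu.
  rewrite uD ?addrA//; exists d => //; exact: Gamma_den_fil.
- move=> [b db <-]; exists x; last by exists b.
  by exists 0; rewrite ?addr0//; exact: Gamma_den0.
Qed.

Definition minimal_hom (M N : filteredModule) (u : M -> N) : Prop :=
  [/\ filtered_hom u,
      forall d, set_surj (@fil M d) (@fil N d) u
    & forall d, set_bij (Gamma M d) (Gamma N d) (Gamma_map u d)].

Section SubFiltered.
Variables (M : filteredModule) (P : submodule M).
Let sfil d : set M := fil d `&` P.

Fact sub_fil0 d : sfil d 0.
Proof. by split; [exact: fil0|exact: submod0]. Qed.

Fact sub_filD d x y : sfil d x -> sfil d y -> sfil d (x + y).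
Proof. by move=> [? ?] [? ?]; split; [exact: filD|exact: submodD]. Qed.

Fact sub_filZ d (c : F) x : sfil d x -> sfil d (c%:MP *: x).
Proof. by move=> [? ?]; split; [exact: filZ|exact: submodZ]. Qed.

Fact sub_fil_mono d : sfil d `<=` sfil d.+1.
Proof. by move=> x [? ?]; split; [exact: fil_mono|]. Qed.

Fact sub_filX d (k : 'I_n) x : sfil d x -> sfil d.+1 ('X_k *: x).
Proof. by move=> [? ?]; split; [exact: filX|exact: submodZ]. Qed.

Definition sub_filtered : filteredModule :=
  FilteredModule sub_fil0 sub_filD sub_filZ sub_fil_mono sub_filX.

End SubFiltered.

(* The a-degree, truncated: deg_a(0) is 0 instead of -oo. It is only taken on
   nonzero vectors or compared with some d >= 0, where this is harmless.
   [msize] is the total degree plus one. *)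
Definition adeg (p : nat) (a : 'I_p -> nat) (f : 'cV[S]_p) : nat :=
  \max_(i < p | f i 0%R != 0%R) (a i + (msize (f i 0%R)).-1)%N.

Section FreeFiltered.
Variables (p : nat) (a : 'I_p -> nat).
Let ffil d : set 'cV[S]_p := [set f | (adeg a f <= d)%N].

Let ffilP d f : ffil d f <->
  forall i, f i 0 != 0 -> (a i + (msize (f i 0%R)).-1 <= d)%N.
Proof. by rewrite /ffil /adeg /=; split => /bigmax_leqP. Qed.

Fact free_fil0 d : ffil d 0.
Proof. by apply/ffilP => i; rewrite mxE eqxx. Qed.

Fact free_filD d x y : ffil d x -> ffil d y -> ffil d (x + y).
Proof.
move=> /ffilP hx /ffilP hy; apply/ffilP => i; rewrite mxE => xy0.
have [x0|x0] := eqVneq (x i 0) 0.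
  by move: xy0; rewrite x0 add0r; exact: hy.
have [y0|y0] := eqVneq (y i 0) 0.
  by move: xy0; rewrite y0 addr0; exact: hx.
have [le_yx|/ltnW le_xy] := leqP (msize (y i 0)) (msize (x i 0)).
- apply: leq_trans (hx i x0); rewrite leq_add2l -!subn1 leq_sub2r//.
  by apply: leq_trans (mmeasureD_le _ _ _) _; rewrite geq_max leqnn.
- apply: leq_trans (hy i y0); rewrite leq_add2l -!subn1 leq_sub2r//.
  by apply: leq_trans (mmeasureD_le _ _ _) _; rewrite geq_max leqnn andbT.
Qed.

Fact free_filZ d (c : F) x : ffil d x -> ffil d (c%:MP *: x).
Proof.
move=> /ffilP hx; apply/ffilP => i; rewrite mxE mul_mpolyC => cx0.
have x0 : x i 0 != 0 by apply: contra_neq cx0 => ->; rewrite scaler0.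
apply: leq_trans (hx i x0); rewrite leq_add2l -!subn1 leq_sub2r//.
exact: msizeZ_le.
Qed.

Fact free_fil_mono d : ffil d `<=` ffil d.+1.
Proof. by move=> x; exact: leqW. Qed.

Fact free_filX d (k : 'I_n) x : ffil d x -> ffil d.+1 ('X_k *: x).
Proof.
move=> /ffilP hx; apply/ffilP => i; rewrite mxE => Xx0.
have x0 : x i 0 != 0 by apply: contra_neq Xx0 => ->; rewrite mulr0.
have X0 : 'X_k != 0 :> S by apply: contra_neq Xx0 => ->; rewrite mul0r.
rewrite msizeM// msizeX mdeg1 !addSn /= add0n.
have: (0 < msize (x i 0%R))%N by rewrite lt0n mmeasure_poly_eq0.
have := hx i x0; case: (msize (x i 0)) => //= m.
by rewrite addnS ltnS.
Qed.

(* S^p[-a] *)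
Definition free_filtered : filteredModule :=
  FilteredModule free_fil0 free_filD free_filZ free_fil_mono free_filX.

End FreeFiltered.

End FilteredModules.

Section Resolutions.
Variables (F : fieldType) (n q : nat).
Local Notation S := {mpoly F[n]}.

(* [cpx_size q p i] is p_i, with p_0 = q and p_{i+1} stored as [p i]. *)
Definition cpx_size (p : nat -> nat) (i : nat) : nat :=
  if i is j.+1 then p j else q.

(* [cpx_mx i] is G_{i+1}; ranks and matrices with index i >= cpx_len are
   irrelevant. *)
Record polyComplex := PolyComplex {
  cpx_len : nat;
  cpx_rk : nat -> nat;
  cpx_mx : forall i, 'M[S]_(cpx_size cpx_rk i, cpx_size cpx_rk i.+1);
  cpx_len_gt0 : (0 < cpx_len)%N;
  cpx_rk_gt0 : forall i, (i < cpx_len)%N -> (0 < cpx_rk i)%N;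
  cpx_col_neq0 : forall i, (i < cpx_len)%N -> forall j, col j (cpx_mx i) != 0;
  cpx_comp0 : forall i, (i.+1 < cpx_len)%N -> cpx_mx i *m cpx_mx i.+1 = 0
}.

(* p_i *)
Definition cpx_dim (G : polyComplex) (i : nat) : nat := cpx_size (cpx_rk G) i.

(* Exactness, at every term except S^q, of
   0 -> S^{p_l} -> ... -> S^{p_1} -> S^q. *)
Definition exact_chain (l : nat) (p : nat -> nat)
    (A : forall i, 'M[S]_(p i, p i.+1)) : Prop :=
  forall i, (i < l)%N ->
    mxker (A i) = (if (i.+1 < l)%N then mxim (A i.+1) : set _ else [set 0])
      :> set _.

Definition is_resolution (G : polyComplex) : Prop :=
  exact_chain (cpx_len G) (@cpx_mx G).

Definition resolution_of (C : submodule 'cV[S]_q) (G : polyComplex) : Prop :=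
  is_resolution G /\ mxim (cpx_mx G 0) = C :> set _.

(* a_i, with a_0 = 0 *)
Fixpoint coldeg (G : polyComplex) (i : nat) : 'I_(cpx_dim G i) -> nat :=
  if i is j.+1 then fun c => adeg (@coldeg G j) (col c (cpx_mx G j))
  else fun=> 0%N.

Arguments coldeg : clear implicits.

(* G_{i+1}^L *)
Definition leading_mx (G : polyComplex) (i : nat) :
    'M[S]_(cpx_dim G i, cpx_dim G i.+1) :=
  \matrix_(r, c)
    if (coldeg G i r <= coldeg G i.+1 c)%N
    then pihomog mdeg (coldeg G i.+1 c - coldeg G i r)%N (cpx_mx G i r c)
    else 0.

Definition is_reduced (G : polyComplex) : Prop :=
  exact_chain (cpx_len G) (leading_mx G).

(* S^{p_i}[-a_i] *)
Definition cpx_free (G : polyComplex) (i : nat) : filteredModule F n :=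
  free_filtered F n (coldeg G i).

(* The codomain of G_{i+1} in the minimality condition: Im(G_1)[0] for i = 0
   (note S^q[-a_0] = S^q[0]), and ker(G_i), filtered from S^{p_i}[-a_i],
   otherwise. *)
Definition cpx_target (G : polyComplex) (i : nat) : filteredModule F n :=
  match i with
  | 0 => sub_filtered (M := cpx_free G 0) (mxim (cpx_mx G 0))
  | j.+1 => sub_filtered (M := cpx_free G j.+1) (mxker (cpx_mx G j))
  end.

Definition cpx_map (G : polyComplex) (i : nat) :
    cpx_free G i.+1 -> cpx_target G i :=
  match i with
  | 0 => fun x : 'cV_(cpx_dim G 1) => cpx_mx G 0 *m x
  | j.+1 => fun x : 'cV_(cpx_dim G j.+2) => cpx_mx G j.+1 *m x
  end.

Definition is_minimal (G : polyComplex) : Prop :=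
  forall i, (i < cpx_len G)%N -> minimal_hom (@cpx_map G i).

Definition minimal_reduced_resolution_of (C : submodule 'cV[S]_q)
    (G : polyComplex) : Prop :=
  [/\ resolution_of C G, is_reduced G & is_minimal G].

Definition resolutions_equivalent (G G' : polyComplex) : Prop :=
  cpx_len G = cpx_len G' /\
  exists U : forall i, 'cV[S]_(cpx_rk G i) -> 'cV[S]_(cpx_rk G' i),
    [/\ forall i, (i < cpx_len G)%N ->
          filtered_iso (M := cpx_free G i.+1) (N := cpx_free G' i.+1) (U i),
        forall x, cpx_mx G' 0 *m U 0%N x = cpx_mx G 0 *m x
      & forall i, (i.+1 < cpx_len G)%N ->
          forall x, cpx_mx G' i.+1 *m U i.+1 x = U i (cpx_mx G i.+1 *m x)].

End Resolutions.

(* Main.v *)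
(** Comparison of minimal generators: a map of codes lifts to the free modules
    covering them, because filtration-preserving surjectivity lets one lift the
    image of each basis vector without raising its degree. Lifting back and
    forth gives an endomorphism [W] of a free filtered module that covers the
    identity, so by minimality [W] is the identity on every [Gamma_d]. By
    induction on [d] (graded Nakayama) [W] is onto in each degree; hence the
    square matrix [W] has a filtered right inverse, which over a commutative
    ring is also a left inverse. Iterating along the resolutions gives the
    equivalence, and exactness at the left end forces the lengths to agree. *)
Require Import Defs.
From mathcomp Require Import all_boot all_order all_algebra.
From mathcomp Require Import boolp classical_sets.
From mathcomp Require Import mpoly.

Set Implicit Arguments.
Unset Strict Implicit.
Unset Printing Implicit Defensive.

Section MinimalResolutions.
Import GRing.Theory.
Local Open Scope ring_scope.
Local Open Scope classical_set_scope.

(** * Matrices as morphisms of free filtered modules *)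

Section FilteredMatrices.
Variables (F : fieldType) (n : nat).
Local Notation S := {mpoly F[n]}.

Lemma adeg_leP p (a : 'I_p -> nat) (f : 'cV[S]_p) d :
  reflect (forall i, f i 0 != 0 -> (a i + (msize (f i 0%R)).-1 <= d)%N)
          (adeg a f <= d)%N.
Proof. exact: bigmax_leqP. Qed.

Lemma adeg_scale p (a : 'I_p -> nat) (s : S) (f : 'cV[S]_p) :
  (adeg a (s *: f) <= (msize s).-1 + adeg a f)%N.
Proof.
apply/adeg_leP => i; rewrite mxE mulf_eq0 negb_or => /andP[s0 f0].
have /adeg_leP/(_ i f0) : (adeg a f <= adeg a f)%N by [].
rewrite msizeM //.
have: (0 < msize s)%N by rewrite lt0n mmeasure_poly_eq0.
have: (0 < msize (f i 0%R))%N by rewrite lt0n mmeasure_poly_eq0.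
case: (msize s) (msize (f i 0)) => // k [] // m _ _ /=.
by rewrite addnS /= addnCA leq_add2l.
Qed.

Definition filtered_mx p r (a : 'I_p -> nat) (b : 'I_r -> nat)
    (U : 'M[S]_(r, p)) : Prop :=
  forall d (x : 'cV[S]_p), (adeg a x <= d)%N -> (adeg b (U *m x) <= d)%N.

Lemma filtered_mx1 p (a : 'I_p -> nat) : filtered_mx a a 1%:M.
Proof. by move=> d x; rewrite mul1mx. Qed.

Lemma filtered_mxM p r s (a : 'I_p -> nat) (b : 'I_r -> nat)
    (c : 'I_s -> nat) (U : 'M[S]_(r, p)) (V : 'M[S]_(s, r)) :
  filtered_mx a b U -> filtered_mx b c V -> filtered_mx a c (V *m U).
Proof. by move=> hU hV d x /hU/hV; rewrite mulmxA. Qed.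

(** Scaling column [j] by [x j 0] adds at most the degree of [x j 0] to its degree, so basis vectors
    suffice. *)
Lemma filtered_mx_col p r (a : 'I_p -> nat) (b : 'I_r -> nat)
    (U : 'M[S]_(r, p)) :
  (forall j, (adeg b (col j U) <= a j)%N) -> filtered_mx a b U.
Proof.
move=> hU d x /adeg_leP hx.
have -> : U *m x = \sum_j x j 0 *: col j U.
  apply/colP => i; rewrite !mxE summxE; apply: eq_bigr => j _.
  by rewrite !mxE mulrC.
elim/big_ind: _ => [|y z|j _].
- exact: (@fil0 _ _ (free_filtered F n b)).
- exact: (@filD _ _ (free_filtered F n b)).
(* The degree hypothesis bounds [a j] only where the entry of [x] is nonzero. *)
have [->|x0] := eqVneq (x j 0) 0.
  by rewrite scale0r; exact: (@fil0 _ _ (free_filtered F n b)).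
apply: leq_trans (hx j x0); apply: leq_trans (adeg_scale _ _ _) _.
by rewrite addnC leq_add2r.
Qed.

Lemma adeg_delta p (a : 'I_p -> nat) (j : 'I_p) :
  (adeg a (delta_mx j 0%R : 'cV[S]_p) <= a j)%N.
Proof.
apply/adeg_leP => i; rewrite mxE andbT; have [->|] := eqVneq i j; last first.
  by rewrite eqxx.
by rewrite msize1 addn0.
Qed.

Lemma filtered_mx_filtered_hom p r (a : 'I_p -> nat) (b : 'I_r -> nat) U :
  filtered_mx a b U ->
  filtered_hom (M := free_filtered F n a) (N := free_filtered F n b)
    (fun x : 'cV_p => U *m x).
Proof.
move=> hU; split; last exact: hU.
- by move=> x y _ _; rewrite mulmxDr.
- by move=> s x _; rewrite -scalemxAr.
Qed.

Lemma filtered_mx_filtered_iso p r (a : 'I_p -> nat) (b : 'I_r -> nat) U V :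
  filtered_mx a b U -> filtered_mx b a V -> V *m U = 1%:M -> U *m V = 1%:M ->
  filtered_iso (M := free_filtered F n a) (N := free_filtered F n b)
    (fun x : 'cV_p => U *m x).
Proof.
move=> hU hV VU UV; split; first exact: filtered_mx_filtered_hom.
exists (fun y : 'cV_r => V *m y); split.
- exact: filtered_mx_filtered_hom.
- by move=> x _; rewrite mulmxA VU mul1mx.
- by move=> y _; rewrite mulmxA UV mul1mx.
Qed.

(** Freeness of the source: chosen preimages of the columns of [B] become the columns of [U]. *)
Lemma filtered_mx_lift p r s (a : 'I_p -> nat) (b : 'I_r -> nat)
    (A : 'M[S]_(s, r)) (B : 'M[S]_(s, p)) :
  (forall j, exists2 y : 'cV_r, (adeg b y <= a j)%N & A *m y = col j B) ->
  exists2 U : 'M_(r, p), filtered_mx a b U & A *m U = B.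
Proof.
move=> hex.
have {hex} /choice[f hf] : forall j, exists y : 'cV[S]_r,
    (adeg b y <= a j)%N /\ A *m y = col j B.
  by move=> j; have [y] := hex j; exists y.
pose U := \matrix_(i, j) f j i 0.
have colU j : col j U = f j by apply/colP => i; rewrite !mxE.
exists U.
  by apply: filtered_mx_col => j; rewrite colU; case: (hf j).
apply/matrixP => i j; have [_ /colP/(_ i)] := hf j.
by rewrite -colU colE mulmxA -colE !mxE.
Qed.

Lemma filtered_mx_inv p (a : 'I_p -> nat) (W : 'M[S]_p) :
  filtered_mx a a W ->
  (forall d (x : 'cV[S]_p), (adeg a x <= d)%N ->
    Gamma_den (M := free_filtered F n a) d (x - W *m x)) ->
  exists2 Z : 'M_p, filtered_mx a a Z & Z *m W = 1%:M /\ W *m Z = 1%:M.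
Proof.
move=> hW hG; pose M := free_filtered F n a.
have onto d : forall x : M, fil d x -> exists2 y : M, fil d y & W *m y = x.
  elim: d => [|d IHd] x dx; have [x0 [x1 [hx0 hx1 xE]]] := hG _ _ dx.
    (* In degree 0 the denominator of [Gamma] is zero, so [W] fixes [x]. *)
    exists x => //; apply/eqP; rewrite eq_sym -subr_eq0 xE (hx0 : x0 = 0) add0r.
    by rewrite big1 // => k _; rewrite (hx1 k : x1 k = 0) scaler0.
  have [y0 dy0 y0E] := IHd _ hx0.
  have /choice[y1 hy1] : forall k, exists y : M, fil d y /\ W *m y = x1 k.
    by move=> k; have [y] := IHd _ (hx1 k); exists y.
  (* By induction [W] maps the added term to [x - W *m x], which corrects the image [W *m x] to
     [x]. *)
  exists (x + (y0 + \sum_k 'X_k *: y1 k)).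
    apply: filD => //; apply: filD; first exact: fil_mono.
    by apply: fil_sum => k; apply: filX; case: (hy1 k).
  rewrite !mulmxDr y0E mulmx_sumr.
  under eq_bigr => k _ do rewrite -scalemxAr (hy1 k).2.
  by rewrite -xE addrC subrK.
have [Z hZ WZ] : exists2 Z : 'M_p, filtered_mx a a Z & W *m Z = 1%:M.
  apply: filtered_mx_lift => j; apply: onto.
  by rewrite col1; exact: adeg_delta.
by exists Z => //; split=> //; exact: mulmx1C.
Qed.

(** * Minimal homomorphisms onto submodules *)

Section Lifting.
Variables (p r : nat) (a : 'I_p -> nat) (b : 'I_r -> nat).
Variables (P : submodule 'cV[S]_r) (A : 'M[S]_(r, p)).

Definition minimal_cover : Prop :=
  minimal_hom (M := free_filtered F n a)
    (N := sub_filtered (M := free_filtered F n b) P)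
    (fun x : 'cV[S]_p => A *m x).

Hypothesis Amin : minimal_cover.

Lemma minimal_cover_fil d (x : 'cV[S]_p) : (adeg a x <= d)%N ->
  (adeg b (A *m x) <= d)%N /\ submod_set P (A *m x).
Proof. by have [[_ _ hf] _ _] := Amin; exact: hf. Qed.

Lemma minimal_cover_surj d (z : 'cV[S]_r) :
  (adeg b z <= d)%N -> submod_set P z ->
  exists2 x : 'cV_p, (adeg a x <= d)%N & A *m x = z.
Proof.
have [_ hs _] := Amin => dz Pz.
by have [x dx xE] := hs d z (conj dz Pz); exists x.
Qed.

(** Since [x] and [W *m x] have the same image under [A], injectivity on [Gamma] identifies their
    cosets. *)
Lemma minimal_cover_inv (W : 'M[S]_p) : filtered_mx a a W -> A *m W = A ->
  exists2 Z : 'M_p, filtered_mx a a Z & Z *m W = 1%:M /\ W *m Z = 1%:M.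
Proof.
move=> hW AW; apply: filtered_mx_inv => // d x dx.
have [hA _ hbij] := Amin; have [_ hinj _] := hbij d.
have dWx := hW d x dx.
pose M := free_filtered F n a.
have eqc : Gamma_coset (M := M) d (W *m x) = Gamma_coset (M := M) d x.
  apply: hinj; [| |by rewrite !Gamma_map_coset // mulmxA AW].
    by apply/mem_set; exists (W *m x).
  by apply/mem_set; exists x.
have : Gamma_coset (M := M) d (W *m x) x.
  by rewrite eqc; exists 0; [exact: Gamma_den0|rewrite addr0].
by move=> [c hc xE]; rewrite -[X in X - _]xE addrC addKr.
Qed.

End Lifting.

Lemma minimal_cover_lift p r p' r' (a : 'I_p -> nat) (b : 'I_r -> nat)
    (a' : 'I_p' -> nat) (b' : 'I_r' -> nat) (P : submodule 'cV[S]_r)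
    (P' : submodule 'cV[S]_r') (A : 'M[S]_(r, p)) (A' : 'M[S]_(r', p'))
    (V : 'M[S]_(r', r)) :
  minimal_cover a b P A -> minimal_cover a' b' P' A' ->
  filtered_mx b b' V -> (forall x, submod_set P x -> submod_set P' (V *m x)) ->
  exists2 U : 'M_(p', p), filtered_mx a a' U & A' *m U = V *m A.
Proof.
move=> hA hA' hV PV; apply: filtered_mx_lift => j.
have [dA PA] := minimal_cover_fil hA (adeg_delta a j).
rewrite colE -mulmxA; apply: (minimal_cover_surj hA'); first exact: hV.
exact: PV.
Qed.

Definition filtered_mx_iso p r (a : 'I_p -> nat) (b : 'I_r -> nat)
    (U : 'M[S]_(r, p)) (V : 'M[S]_(p, r)) : Prop :=
  [/\ filtered_mx a b U, filtered_mx b a V, V *m U = 1%:M & U *m V = 1%:M].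

Lemma minimal_cover_iso p r p' r' (a : 'I_p -> nat) (b : 'I_r -> nat)
    (a' : 'I_p' -> nat) (b' : 'I_r' -> nat) (P : submodule 'cV[S]_r)
    (P' : submodule 'cV[S]_r') (A : 'M[S]_(r, p)) (A' : 'M[S]_(r', p'))
    (V : 'M[S]_(r', r)) (V' : 'M[S]_(r, r')) :
  minimal_cover a b P A -> minimal_cover a' b' P' A' ->
  filtered_mx_iso b b' V V' ->
  (forall x, submod_set P x -> submod_set P' (V *m x)) ->
  (forall x, submod_set P' x -> submod_set P (V' *m x)) ->
  exists U U', filtered_mx_iso a a' U U' /\ A' *m U = V *m A.
Proof.
move=> hA hA' [hV hV' VV' V'V] PV PV'.
have [U hU UE] := minimal_cover_lift hA hA' hV PV.
have [T hT TE] := minimal_cover_lift hA' hA hV' PV'.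
have [|Z hZ [ZL _]] := minimal_cover_inv hA (filtered_mxM hU hT).
  by rewrite mulmxA TE -mulmxA UE mulmxA VV' mul1mx.
have [|Z' hZ' [_ Z'R]] := minimal_cover_inv hA' (filtered_mxM hT hU).
  by rewrite mulmxA UE -mulmxA TE mulmxA V'V mul1mx.
(* The ranks [p] and [p'] may differ a priori, so [U] needs inverses on both sides: [Z *m T] on the
   left and [T *m Z'] on the right, which must coincide. *)
exists U, (Z *m T); split=> //; split=> //.
- exact: filtered_mxM hT hZ.
- by rewrite -mulmxA.
- have -> : Z *m T = T *m Z'.
    by rewrite -[LHS]mulmx1 -Z'R !mulmxA -(mulmxA Z) ZL mul1mx.
  by rewrite mulmxA.
Qed.

End FilteredMatrices.

(** * Comparison of two minimal resolutions *)

Section Resolutions.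
Variables (F : fieldType) (n q : nat).
Local Notation S := {mpoly F[n]}.
Implicit Types G : polyComplex F n q.

(** The submodule covered by [cpx_mx G i]; treating the image and the kernels alike makes the
    induction along the resolution uniform. *)
Definition syzygies G i : submodule 'cV[S]_(cpx_dim G i) :=
  match i with
  | 0 => mxim (cpx_mx G 0)
  | j.+1 => mxker (cpx_mx G j)
  end.

Lemma is_minimal_cover G i : is_minimal G -> (i < cpx_len G)%N ->
  minimal_cover (@coldeg _ _ _ G i.+1) (@coldeg _ _ _ G i) (syzygies G i)
    (cpx_mx G i).
Proof. by case: i => [|i] hG /hG. Qed.

Lemma syzygies_len G (y : 'cV[S]_(cpx_dim G (cpx_len G))) :
  is_resolution G -> submod_set (syzygies G (cpx_len G)) y -> y = 0.
Proof.
move=> rG; suff H i (z : 'cV[S]_(cpx_dim G i)) :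
  (0 < i)%N -> i = cpx_len G -> submod_set (syzygies G i) z -> z = 0.
  by apply: H => //; exact: cpx_len_gt0.
case: i z => // i z _ iG zker; have lt_i : (i < cpx_len G)%N by rewrite -iG.
have lt_i1 : (i.+1 < cpx_len G)%N = false by rewrite -iG ltnn.
by have := rG i lt_i; rewrite lt_i1 => /seteqP[/(_ _ zker)].
Qed.

Lemma syzygies_col G i j : (0 < i < cpx_len G)%N ->
  submod_set (syzygies G i) (col j (cpx_mx G i)).
Proof.
case: i j => // i j /= iG.
by rewrite colE mulmxA cpx_comp0 // mul0mx.
Qed.

(** The invariant of the induction: an isomorphism of the free modules that also matches the
    submodules to be covered next. *)
Definition syzygy_iso G G' i (V : 'M[S]_(cpx_dim G' i, cpx_dim G i)) : Prop :=
  exists V', [/\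
    filtered_mx_iso (@coldeg _ _ _ G i) (@coldeg _ _ _ G' i) V V',
    forall x, submod_set (syzygies G i) x ->
      submod_set (syzygies G' i) (V *m x)
    & forall x, submod_set (syzygies G' i) x ->
      submod_set (syzygies G i) (V' *m x)].

Lemma syzygy_iso1 G G' :
  mxim (cpx_mx G 0) = mxim (cpx_mx G' 0) :> set _ ->
  syzygy_iso (G := G) (G' := G') (i := 0) 1%:M.
Proof.
move=> eqim; exists 1%:M; split.
- by split; rewrite ?mul1mx //; exact: filtered_mx1.
- by move=> x; rewrite mul1mx [syzygies G 0]/= eqim.
- by move=> x; rewrite mul1mx [syzygies G 0]/= eqim.
Qed.

Lemma syzygy_iso_step G G' i (V : 'M[S]_(cpx_dim G' i, cpx_dim G i)) :
  is_minimal G -> is_minimal G' -> (i < cpx_len G)%N -> (i < cpx_len G')%N ->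
  syzygy_iso V ->
  exists2 U : 'M[S]_(cpx_dim G' i.+1, cpx_dim G i.+1),
    syzygy_iso U & cpx_mx G' i *m U = V *m cpx_mx G i.
Proof.
move=> mG mG' iG iG' [V' [Viso PV PV']].
have [U [U' [Uiso UE]]] := minimal_cover_iso (is_minimal_cover mG iG)
  (is_minimal_cover mG' iG') Viso PV PV'.
exists U => //; exists U'; split=> // x /= xker.
  by rewrite mulmxA UE -mulmxA xker mulmx0.
(* Inverting the commuting square gives [cpx_mx G i *m U' = V' *m cpx_mx G' i], so [U'] preserves
   kernels too. *)
have [_ _ _ UU'] := Uiso; have [_ _ V'V _] := Viso.
rewrite -[LHS]mul1mx -V'V -mulmxA [V *m _]mulmxA -UE -mulmxA.
by rewrite [U *m _]mulmxA UU' mul1mx xker mulmx0.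
Qed.

(** Each stage is chosen to commute with the one already chosen; the default 0 only matters when no
    such matrix exists. *)
Fixpoint comparison_mx G G' i : 'M[S]_(cpx_dim G' i, cpx_dim G i) :=
  if i is j.+1 then
    xget 0 [set U : 'M[S]_(cpx_dim G' j.+1, cpx_dim G j.+1) |
      syzygy_iso U /\ cpx_mx G' j *m U = comparison_mx G G' j *m cpx_mx G j]
  else 1%:M.

Section Comparison.
Variables (G G' : polyComplex F n q).
Hypotheses (mG : is_minimal G) (mG' : is_minimal G').
Hypothesis eqim : mxim (cpx_mx G 0) = mxim (cpx_mx G' 0) :> set _.

Lemma comparison_mx_iso i : (i <= cpx_len G)%N -> (i <= cpx_len G')%N ->
  syzygy_iso (comparison_mx G G' i).
Proof.
elim: i => [|i IHi] iG iG'; first exact: syzygy_iso1.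
have [U hU UE] := syzygy_iso_step mG mG' iG iG' (IHi (ltnW iG) (ltnW iG')).
by rewrite /=; case: xgetP => [W _ []//|/(_ U)[]].
Qed.

Lemma comparison_mx_comm i : (i < cpx_len G)%N -> (i < cpx_len G')%N ->
  cpx_mx G' i *m comparison_mx G G' i.+1 =
  comparison_mx G G' i *m cpx_mx G i.
Proof.
move=> iG iG'.
have [U hU UE] := syzygy_iso_step mG mG' iG iG'
  (comparison_mx_iso (ltnW iG) (ltnW iG')).
by rewrite /=; case: xgetP => [W _ []//|/(_ U)[]].
Qed.

(** If [G'] were longer, its syzygies at position [cpx_len G] would contain a nonzero column of its
    next matrix, yet they are isomorphic to those of [G], which vanish by exactness at the left
    end. *)
Lemma minimal_resolution_len_le : is_resolution G ->
  (cpx_len G' <= cpx_len G)%N.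
Proof.
move=> rG; rewrite leqNgt; apply/negP => ltG.
have [V' [[_ _ _ VV'] _ kerV']] := comparison_mx_iso (leqnn _) (ltnW ltG).
pose y := col (Ordinal (cpx_rk_gt0 ltG)) (cpx_mx G' (cpx_len G)).
have /eqP[] : y != 0 by exact: cpx_col_neq0.
have /kerV'/(syzygies_len rG) V'y : submod_set (syzygies G' (cpx_len G)) y.
  by apply: syzygies_col; rewrite cpx_len_gt0.
by rewrite -[y]mul1mx -VV' -mulmxA V'y mulmx0.
Qed.

End Comparison.
End Resolutions.
End MinimalResolutions.

Theorem theorem3 (F : fieldType) (n q : nat) (n_gt0 : (0 < n)%N)
    (C : submodule 'cV[{mpoly F[n]}]_q) (G G' : polyComplex F n q) :
  minimal_reduced_resolution_of C G -> minimal_reduced_resolution_of C G' ->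
  resolutions_equivalent G G'.
Proof.
move=> [[rG imG] _ mG] [[rG' imG'] _ mG'].
have eqim : mxim (cpx_mx G 0) = mxim (cpx_mx G' 0) :> set _.
  by rewrite imG imG'.
have eql : cpx_len G = cpx_len G'.
  apply/eqP; rewrite eqn_leq.
  by rewrite (minimal_resolution_len_le mG' mG) // minimal_resolution_len_le.
(* The index shifts because [U i] acts on the free module of position [i.+1]; position 0 carries the
   identity of [S^q]. *)
split=> //; exists (fun i x => comparison_mx G G' i.+1 *m x)%R; split.
- move=> i iG; have iG' : (i < cpx_len G')%N by rewrite -eql.
  have [V' [[hV hV' V'V VV'] _ _]] := comparison_mx_iso mG mG' eqim iG iG'.
  exact: filtered_mx_filtered_iso hV hV' V'V VV'.
- move=> x; rewrite mulmxA comparison_mx_comm ?cpx_len_gt0 //.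
  by rewrite mul1mx.
- move=> i iG x; rewrite !mulmxA comparison_mx_comm //.
  by rewrite -eql.
Qed.
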